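(* Let $\mathbf{FinGrp}$ and $\mathbf{FinPos}$ denote the categories of finite groups (and homomorphisms) and finite posets (and order-preserving maps). Then the assignments $G\mapsto\mathbf{Tr}(G)$, $f\mapsto f_L,\ f_R,\ f^{-1}_L,\ f^{-1}_R$ determine functors $$(-)_L,\ (-)_R:\mathbf{FinGrp}\rightrightarrows\mathbf{FinPos}\quad\text{and}\quad(-)^{-1}_L,\ (-)^{-1}_R:\mathbf{FinGrp}^{\mathrm{op}}\rightrightarrows\mathbf{FinPos}$$ such that for any homomorphism $f:G\to G'$ in $\mathbf{FinGrp}$, there are order adjunctions $f_L\dashv f^{-1}_R$ (with $f_L:\mathbf{Tr}(G)\rightleftarrows\mathbf{Tr}(G'):f^{-1}_R$) and $f^{-1}_L\dashv f_R$ (with $f^{-1}_L:\mathbf{Tr}(G')\rightleftarrows\mathbf{Tr}(G):f_R$).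
   Context: For a finite group $G$, $\mathbf{Sub}(G)$ is the set of subgroups of $G$. A $G$-transfer system is a partial order $\to$ on $\mathbf{Sub}(G)$ such that $K\to H$ implies: $K\subset H$; $gKg^{-1}\to gHg^{-1}$ for every $g\in G$; and $L\cap K\to L$ for every subgroup $L\subset H$. Relations are identified with sets of pairs, and $\mathbf{Tr}(G)$ is the set of $G$-transfer systems ordered by inclusion (refinement). Every relation on $\mathbf{Sub}(G)$ refining inclusion is contained in a least transfer system, and every partial order on $\mathbf{Sub}(G)$ refining inclusion contains a largest transfer system. Let $f:G\to G'$ be a homomorphism between finite groups. For $\to\ \in\mathbf{Tr}(G)$ and $\rightsquigarrow\ \in\mathbf{Tr}(G')$: - $f_L(\to)$ is the least $G'$-transfer system containing $\{(f(K),f(H))\mid K\to H\}$; - $f^{-1}_R(\rightsquigarrow)$ is the largest $G$-transfer system contained in $\{(K,H)\mid K\subset H\subset G,\ f(K)\rightsquigarrow f(H)\}$; - $f^{-1}_L(\rightsquigarrow)$ is the least $G$-transfer system containing $\{(f^{-1}K',f^{-1}H')\mid K'\rightsquigarrow H'\}$; - $f_R(\to)$ is the largest $G'$-transfer system contained in $\{(K',H')\mid K'\subset H'\subset G',\ f^{-1}K'\to f^{-1}H'\}$. An order adjunction (Galois connection) $a\dashv b$ means $a(x)\le y\iff x\le b(y)$. *)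

(* Defs.v *)
From HB Require Import structures.
From mathcomp Require Import all_boot all_order all_fingroup.
From Stdlib Require Import FunctionalExtensionality ProofIrrelevance.

Set Implicit Arguments.
Unset Strict Implicit.
Unset Printing Implicit Defensive.

Import Order.TTheory.
Local Open Scope group_scope.

Section TransferSystem.
Variable gT : finGroupType.
Implicit Types (K H L : {group gT}) (R P : {set {group gT} * {group gT}}).

Definition partial_order R : bool :=
  [&& [forall H, (H, H) \in R],
      [forall K, forall H, ((K, H) \in R) && ((H, K) \in R) ==> (K == H)] &
      [forall L, forall K, forall H,
         ((L, K) \in R) && ((K, H) \in R) ==> ((L, H) \in R)]].

Definition refines_inclusion R : bool :=
  [forall K, forall H, ((K, H) \in R) ==> (K \subset H)].

(* In MathComp, K :^ x is x^-1 K x, so K :^ g^-1 is g K g^-1. *)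
Definition conj_closed R : bool :=
  [forall K, forall H, forall g : gT,
     ((K, H) \in R) ==> (((K :^ g^-1)%G, (H :^ g^-1)%G) \in R)].

Definition res_closed R : bool :=
  [forall K, forall H, forall L : {group gT},
     ((K, H) \in R) && (L \subset H) ==> (((L :&: K)%G, L) \in R)].

Definition is_transfer R : bool :=
  [&& partial_order R, refines_inclusion R, conj_closed R & res_closed R].

Record transfer_system := TransferSystem {
  transfers :> {set {group gT} * {group gT}};
  _ : is_transfer transfers }.

HB.instance Definition _ := [isSub for transfers].
HB.instance Definition _ := [Finite of transfer_system by <:].

Definition transfer_le (s t : transfer_system) : bool :=
  transfers s \subset transfers t.

Lemma transfer_le_refl : reflexive transfer_le.
Proof. by move=> s; apply: subxx. Qed.

Lemma transfer_le_anti : antisymmetric transfer_le.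
Proof. by move=> s t sts; apply/val_inj/eqP; rewrite eqEsubset. Qed.

Lemma transfer_le_trans : transitive transfer_le.
Proof. by move=> t s u; apply: subset_trans. Qed.

Fact transfer_display : Order.disp_t. Proof. exact: Order.Disp tt tt. Qed.

HB.instance Definition _ := Order.Le_isPOrder.Build transfer_display
  transfer_system transfer_le_refl transfer_le_anti transfer_le_trans.

Lemma is_transferP R :
  reflect
    [/\ forall H, (H, H) \in R,
        forall L K H, (L, K) \in R -> (K, H) \in R -> (L, H) \in R,
        forall K H, (K, H) \in R -> K \subset H,
        forall K H g, (K, H) \in R -> ((K :^ g^-1)%G, (H :^ g^-1)%G) \in R &
        forall K H L, (K, H) \in R -> L \subset H -> ((L :&: K)%G, L) \in R]
    (is_transfer R).
Proof.
apply: (iffP idP) => [/and4P[/and3P[/forallP rR _ tR] iR cR sR] | ].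
  split=> // [L K H LK KH | K H KH | K H g KH | K H L KH LH].
  - by move/forallP/(_ L)/forallP/(_ K)/forallP/(_ H)/implyP: tR; apply; apply/andP.
  - by move/forallP/(_ K)/forallP/(_ H)/implyP: iR; apply.
  - by move/forallP/(_ K)/forallP/(_ H)/forallP/(_ g)/implyP: cR; apply.
  - by move/forallP/(_ K)/forallP/(_ H)/forallP/(_ L)/implyP: sR; apply; apply/andP.
move=> [rR tR iR cR sR]; apply/and4P; split; first (apply/and3P; split).
- exact/forallP.
- apply/forallP=> K; apply/forallP=> H; apply/implyP=> /andP[/iR KH /iR HK].
  by apply/eqP/group_inj/eqP; rewrite eqEsubset KH.
- apply/forallP=> L; apply/forallP=> K; apply/forallP=> H.
  by apply/implyP=> /andP[]; apply: tR.
- by apply/forallP=> K; apply/forallP=> H; apply/implyP; apply: iR.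
- apply/forallP=> K; apply/forallP=> H; apply/forallP=> g.
  by apply/implyP; apply: cR.
- apply/forallP=> K; apply/forallP=> H; apply/forallP=> L.
  by apply/implyP=> /andP[]; apply: sR.
Qed.

Fact eq_is_transfer : is_transfer [set p | p.1 == p.2].
Proof.
apply/is_transferP; split=> [H|L K H|K H|K H g|K H L]; rewrite !inE //=.
- by move=> /eqP->.
- by move=> /eqP->.
- by move=> /eqP->.
- by move=> /eqP-> LH; apply/eqP/group_inj/setIidPl.
Qed.

Definition eq_transfer : transfer_system := TransferSystem eq_is_transfer.

Definition least_containing R (t : transfer_system) : bool :=
  (R \subset t) &&
  [forall t' : transfer_system, (R \subset t') ==> (t <= t')%O].

Definition largest_contained P (t : transfer_system) : bool :=
  ((t : {set _}) \subset P) &&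
  [forall t' : transfer_system,
     ((t' : {set _}) \subset P) ==> (t' <= t)%O].

(* The default eq_transfer is only reached outside the domain of               *)
(* least_transferP, resp. largest_transferP.                                   *)
Definition least_transfer R : transfer_system :=
  odflt eq_transfer [pick t | least_containing R t].

Definition largest_transfer P : transfer_system :=
  odflt eq_transfer [pick t | largest_contained P t].

Lemma least_transferP R :
  refines_inclusion R -> least_containing R (least_transfer R).
Proof.
move=> iR; rewrite /least_transfer; case: pickP => //= none; exfalso.
pose S := [set p | [forall t : transfer_system, (R \subset t) ==> (p \in transfers t)]].
have inS p : reflect (forall t : transfer_system, R \subset t -> p \in transfers t)
               (p \in S).
  by rewrite inE; apply: (iffP forallP) => h t; apply/implyP/h.
have incl : is_transfer [set p : {group gT} * {group gT} | p.1 \subset p.2].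
  apply/is_transferP; split=> [H|L K H|K H|K H g|K H L]; rewrite !inE ?subxx //=.
  - exact: subset_trans.
  - by rewrite conjSg.
  - by rewrite subsetIl.
have trS : is_transfer S.
  apply/is_transferP; split=> [H|L K H|K H|K H g|K H L].
  - by apply/inS=> t _; case: (is_transferP _ (valP t)).
  - move=> /inS LK /inS KH; apply/inS=> t Rt.
    by have [_ tt _ _ _] := is_transferP _ (valP t); apply: tt (LK t Rt) (KH t Rt).
  - move=> /inS/(_ (TransferSystem incl)); rewrite inE; apply.
    apply/subsetP=> -[K' H'] R'; rewrite inE /=.
    by move/forallP/(_ K')/forallP/(_ H')/implyP: iR; apply.
  - move=> /inS KH; apply/inS=> t Rt.
    by have [_ _ _ ct _] := is_transferP _ (valP t); apply/ct/KH.
  - move=> /inS KH LH; apply/inS=> t Rt.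
    by have [_ _ _ _ st] := is_transferP _ (valP t); apply: st (KH t Rt) LH.
have /negP[] := negbT (none (TransferSystem trS)).
apply/andP; split; first by apply/subsetP=> p Rp; apply/inS=> t /subsetP; apply.
by apply/forallP=> t; apply/implyP=> Rt; apply/subsetP=> p /inS; apply.
Qed.

Lemma largest_transferP P :
  partial_order P -> refines_inclusion P ->
  largest_contained P (largest_transfer P).
Proof.
move=> oP iP; rewrite /largest_transfer; case: pickP => //= none; exfalso.
case/and3P: oP => /forallP rP _ /forallP tP.
have {}tP L K H : (L, K) \in P -> (K, H) \in P -> (L, H) \in P.
  by move: (tP L) => /forallP/(_ K)/forallP/(_ H)/implyP h LK KH; apply/h/andP.
pose S := [set p : {group gT} * {group gT} | (p.1 \subset p.2) &&
  [forall g : gT, forall L : {group gT}, (L \subset p.2) ==>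
     (((((L :&: p.1) :^ g^-1)%G), (L :^ g^-1)%G) \in P)]].
have inS K H : reflect (K \subset H /\ forall g L, L \subset H ->
     ((((L :&: K) :^ g^-1)%G), (L :^ g^-1)%G) \in P) ((K, H) \in S).
  rewrite inE /=; apply: (iffP andP) => -[KH h]; split=> //.
    by move=> g L; apply/implyP; move: h => /forallP/(_ g)/forallP/(_ L).
  by apply/forallP=> g; apply/forallP=> L; apply/implyP/h.
have trS : is_transfer S.
  apply/is_transferP; split=> [H|L K H|K H|K H g|K H L].
  - apply/inS; split=> // g L /setIidPl LH.
    by have -> : (L :&: H)%G = L by apply: group_inj.
  - move=> /inS[LK h1] /inS[KH h2]; apply/inS.
    split=> [|g M MH]; first exact: subset_trans LK KH.
    apply: tP (h2 g M MH).
    have := h1 g (M :&: K)%G (subsetIr _ _).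
    suff -> : (M :&: K :&: L)%G = (M :&: L)%G by [].
    by apply: group_inj; rewrite /= -setIA (setIidPr LK).
  - by case/inS.
  - move=> /inS[KH h]; apply/inS; split=> [|a L LH]; first by rewrite conjSg.
    have LH' : (L :^ g)%G \subset H by rewrite /= sub_conjg.
    have := h (a * g) (L :^ g)%G LH'.
    have -> : (((L :^ g) :&: K) :^ (a * g)^-1)%G = ((L :&: (K :^ g^-1)) :^ a^-1)%G.
      by apply: group_inj; rewrite /= invMg conjsgM conjIg conjsgK.
    suff -> : ((L :^ g) :^ (a * g)^-1)%G = (L :^ a^-1)%G by [].
    by apply: group_inj; rewrite /= invMg conjsgM conjsgK.
  - move=> /inS[KH h] LH; apply/inS; split=> [|g M ML]; first exact: subsetIl.
    have := h g M (subset_trans ML LH).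
    suff -> : (M :&: K)%G = (M :&: (L :&: K))%G by [].
    by apply: group_inj; rewrite /= setIA (setIidPl ML).
have /negP[] := negbT (none (TransferSystem trS)).
apply/andP; split.
  apply/subsetP=> -[K H] /inS[KH /(_ 1 H (subxx _))].
  have -> : ((H :&: K) :^ 1^-1)%G = K.
    by apply: group_inj; rewrite /= invg1 conjsg1 (setIidPr KH).
  by have -> : (H :^ 1^-1)%G = H by apply: group_inj; rewrite /= invg1 conjsg1.
apply/forallP=> t; apply/implyP=> /subsetP tP'; apply/subsetP=> -[K H] tKH.
have [_ _ it ct st] := is_transferP _ (valP t).
by apply/inS; split=> [|g L LH]; [apply: it | apply: tP'; apply/ct/(st _ H)].
Qed.

End TransferSystem.

Section Induced.
Variables (gT rT : finGroupType) (f : {morphism [set: gT] >-> rT}).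

Definition f_L (s : transfer_system gT) : transfer_system rT :=
  least_transfer [set ((f @* p.1)%G, (f @* p.2)%G) | p in transfers s].

Definition finv_R (t : transfer_system rT) : transfer_system gT :=
  largest_transfer [set p : {group gT} * {group gT} |
    (p.1 \subset p.2) && (((f @* p.1)%G, (f @* p.2)%G) \in transfers t)].

Definition finv_L (t : transfer_system rT) : transfer_system gT :=
  least_transfer [set ((f @*^-1 p.1)%G, (f @*^-1 p.2)%G) | p in transfers t].

Definition f_R (s : transfer_system gT) : transfer_system rT :=
  largest_transfer [set p : {group rT} * {group rT} |
    (p.1 \subset p.2) && (((f @*^-1 p.1)%G, (f @*^-1 p.2)%G) \in transfers s)].

(* These four lemmas show that the relations above are in the domain of        *)
(* least_transferP, resp. largest_transferP.                                   *)
Lemma f_L_least s :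
  least_containing [set ((f @* p.1)%G, (f @* p.2)%G) | p in transfers s] (f_L s).
Proof.
apply: least_transferP; apply/forallP=> K'; apply/forallP=> H'; apply/implyP.
have [_ _ is_ _ _] := is_transferP _ (valP s).
by case/imsetP=> -[K H] /is_ KH [-> ->]; apply: morphimS.
Qed.

Lemma finv_L_least t :
  least_containing [set ((f @*^-1 p.1)%G, (f @*^-1 p.2)%G) | p in transfers t]
    (finv_L t).
Proof.
apply: least_transferP; apply/forallP=> K'; apply/forallP=> H'; apply/implyP.
have [_ _ it _ _] := is_transferP _ (valP t).
by case/imsetP=> -[K H] /it KH [-> ->]; apply: morphpreS.
Qed.

Lemma finv_R_largest t :
  largest_contained [set p : {group gT} * {group gT} |
    (p.1 \subset p.2) && (((f @* p.1)%G, (f @* p.2)%G) \in transfers t)]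
    (finv_R t).
Proof.
have [rt tt _ _ _] := is_transferP _ (valP t).
apply: largest_transferP; last first.
  apply/forallP=> K; apply/forallP=> H; apply/implyP.
  by rewrite inE /= => /andP[].
apply/and3P; split.
- by apply/forallP=> H; rewrite inE /= subxx rt.
- apply/forallP=> K; apply/forallP=> H; apply/implyP.
  rewrite !inE /= => /andP[/andP[KH _] /andP[HK _]].
  by apply/eqP/group_inj/eqP; rewrite eqEsubset KH.
- apply/forallP=> L; apply/forallP=> K; apply/forallP=> H; apply/implyP.
  rewrite !inE /= => /andP[/andP[LK h1] /andP[KH h2]].
  by rewrite (subset_trans LK KH) (tt _ _ _ h1 h2).
Qed.

Lemma f_R_largest s :
  largest_contained [set p : {group rT} * {group rT} |
    (p.1 \subset p.2) && (((f @*^-1 p.1)%G, (f @*^-1 p.2)%G) \in transfers s)]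
    (f_R s).
Proof.
have [rs ts _ _ _] := is_transferP _ (valP s).
apply: largest_transferP; last first.
  apply/forallP=> K; apply/forallP=> H; apply/implyP.
  by rewrite inE /= => /andP[].
apply/and3P; split.
- by apply/forallP=> H; rewrite inE /= subxx rs.
- apply/forallP=> K; apply/forallP=> H; apply/implyP.
  rewrite !inE /= => /andP[/andP[KH _] /andP[HK _]].
  by apply/eqP/group_inj/eqP; rewrite eqEsubset KH.
- apply/forallP=> L; apply/forallP=> K; apply/forallP=> H; apply/implyP.
  rewrite !inE /= => /andP[/andP[LK h1] /andP[KH h2]].
  by rewrite (subset_trans LK KH) (ts _ _ _ h1 h2).
Qed.

End Induced.

Definition order_adjunction d (X : porderType d) d' (Y : porderType d')
  (a : X -> Y) (b : Y -> X) : Prop :=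
  forall x y, (a x <= y)%O <-> (x <= b y)%O.

Record category := Category {
  obj :> Type;
  hom : obj -> obj -> Type;
  idc : forall a, hom a a;
  compc : forall a b c, hom b c -> hom a b -> hom a c;
  compc1 : forall a b (f : hom a b), compc f (idc a) = f;
  comp1c : forall a b (f : hom a b), compc (idc b) f = f;
  compcA : forall a b c d (h : hom c d) (g : hom b c) (f : hom a b),
    compc h (compc g f) = compc (compc h g) f }.

Definition op (C : category) : category :=
  @Category C (fun a b => hom b a) (@idc C) (fun a b c g f => compc f g)
    (fun a b f => comp1c f) (fun a b f => compc1 f)
    (fun a b c d h g f => esym (compcA f g h)).

(* Functors with a prescribed action on objects. *)
Record functor_on (C D : category) (F0 : C -> D) := FunctorOn {
  fmap : forall a b : C, hom a b -> hom (F0 a) (F0 b);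
  fmap_id : forall a : C, fmap (idc a) = idc (F0 a);
  fmap_comp : forall (a b c : C) (g : hom b c) (f : hom a b),
    fmap (compc g f) = compc (fmap g) (fmap f) }.

(* MathComp's idm and composite of morphisms f, g on full groups; the latter   *)
(* is rebuilt because the domain of the library's g \o f is f @*^-1 [set: _].  *)
Lemma compm_morphM (aT bT cT : finGroupType)
    (g : {morphism [set: bT] >-> cT}) (f : {morphism [set: aT] >-> bT}) :
  {in [set: aT] &, {morph g \o f : x y / x * y}}.
Proof. by move=> x y _ _ /=; rewrite !morphM ?inE. Qed.

Definition compm (aT bT cT : finGroupType)
    (g : {morphism [set: bT] >-> cT}) (f : {morphism [set: aT] >-> bT}) :
  {morphism [set: aT] >-> cT} := Morphism (compm_morphM g f).

Lemma morphism_eq (aT bT : finGroupType) (f g : {morphism [set: aT] >-> bT}) :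
  f =1 g -> f = g.
Proof.
case: f g => [f fM] [g gM] /= /functional_extensionality fg.
by case: _ / fg gM => gM; congr Morphism; apply: proof_irrelevance.
Qed.

Lemma compm1 (aT bT : finGroupType) (f : {morphism [set: aT] >-> bT}) :
  compm f (idm_morphism [set: aT]) = f.
Proof. exact: morphism_eq. Qed.

Lemma comp1m (aT bT : finGroupType) (f : {morphism [set: aT] >-> bT}) :
  compm (idm_morphism [set: bT]) f = f.
Proof. exact: morphism_eq. Qed.

Lemma compmA (aT bT cT dT : finGroupType) (h : {morphism [set: cT] >-> dT})
    (g : {morphism [set: bT] >-> cT}) (f : {morphism [set: aT] >-> bT}) :
  compm h (compm g f) = compm (compm h g) f.
Proof. exact: morphism_eq. Qed.

Definition FinGrp : category :=
  @Category finGroupType (fun aT bT => {morphism [set: aT] >-> bT})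
    (fun aT => idm_morphism [set: aT]) compm compm1 comp1m compmA.

Record finPoset := FinPoset {
  finPoset_disp : Order.disp_t;
  finPoset_sort :> finPOrderType finPoset_disp }.

Lemma omorphism_eq d (X : porderType d) d' (Y : porderType d')
    (f g : {omorphism X -> Y}) : f =1 g -> f = g.
Proof.
case: f g => [f [[fM]]] [g [[gM]]] /= /functional_extensionality fg.
by case: _ / fg gM => gM; rewrite (proof_irrelevance _ fM gM).
Qed.

Section FinPosLaws.
Variables X Y Z W : finPoset.

Definition compo (g : {omorphism Y -> Z}) (f : {omorphism X -> Y}) :
  {omorphism X -> Z} := (g \o f).

Lemma compo1 (f : {omorphism X -> Y}) : (f \o idfun : {omorphism X -> Y}) = f.
Proof. exact: omorphism_eq. Qed.

Lemma comp1o (f : {omorphism X -> Y}) : (idfun \o f : {omorphism X -> Y}) = f.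
Proof. exact: omorphism_eq. Qed.

Lemma compoA (h : {omorphism Z -> W}) (g : {omorphism Y -> Z})
    (f : {omorphism X -> Y}) :
  (h \o (g \o f) : {omorphism X -> W}) = ((h \o g) \o f : {omorphism X -> W}).
Proof. exact: omorphism_eq. Qed.

End FinPosLaws.

Definition FinPos : category :=
  @Category finPoset (fun X Y => {omorphism X -> Y})
    (fun X => idfun : {omorphism X -> X}) compo compo1 comp1o compoA.

Definition Tr (G : FinGrp) : FinPos := FinPoset (transfer_system G).

(* Main.v *)
(** Both adjunctions hold because a transfer system refines inclusion, so the
    side condition in the relations defining [finv_R] and [f_R] is automatic.
    Adjoints being unique, functoriality of [f_L] and [finv_L] reduces to that of
    their right adjoints, for which the largest transfer system is explicit:
    the relation pulled back along images is already closed under conjugation,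
    so only closure under restriction is to be imposed, and the one pulled back
    along preimages is already closed under restriction, so only closure under
    conjugation is. *)
Require Import Defs.
From HB Require Import structures.
From mathcomp Require Import all_boot all_order all_fingroup.

Set Implicit Arguments.
Unset Strict Implicit.
Unset Printing Implicit Defensive.

Import Order.TTheory.
Local Open Scope group_scope.

(** * Order adjunctions between posets *)

Section Adjunctions.
Context d (X : porderType d) d' (Y : porderType d').
Implicit Types (a : X -> Y) (b : Y -> X).

(** Transpose [x <= y <= b (a y)]. With its dual for right adjoints, this supplies the order
    preservation of all four induced maps. *)
Lemma adjunction_homo_left a b :
  order_adjunction a b -> {homo a : x y / (x <= y)%O}.
Proof. by move=> ab x y xy; apply/ab/(le_trans xy)/ab. Qed.

Lemma adjunction_homo_right a b :
  order_adjunction a b -> {homo b : x y / (x <= y)%O}.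
Proof. by move=> ab x y xy; apply/ab/le_trans/xy/ab. Qed.

Lemma left_adjoint_unique a a' b b' :
  order_adjunction a b -> order_adjunction a' b' -> b =1 b' -> a =1 a'.
Proof.
move=> ab a'b' bb' x; apply/le_anti/andP; split.
  by apply/ab; rewrite bb'; apply/a'b'.
by apply/a'b'; rewrite -bb'; apply/ab.
Qed.

End Adjunctions.

Lemma adjunction_id d (X : porderType d) :
  order_adjunction (@id X) (@id X).
Proof. by []. Qed.

Lemma adjunction_comp d (X : porderType d) d' (Y : porderType d')
    d'' (Z : porderType d'') (a : X -> Y) b (a' : Y -> Z) b' :
  order_adjunction a b -> order_adjunction a' b' ->
  order_adjunction (a' \o a) (b \o b').
Proof. by move=> ab a'b' x z; split=> [/a'b'/ab | /ab/a'b']. Qed.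

(** * Closure properties and universal properties of transfer systems *)

Section TransferLemmas.
Variable gT : finGroupType.
Implicit Types (t : transfer_system gT) (K H L : {group gT}).
Implicit Types (R : {set {group gT} * {group gT}}).

Lemma transfer_refl t H : (H, H) \in transfers t.
Proof. by have [rt _ _ _ _] := is_transferP _ (valP t). Qed.

Lemma transfer_trans t L K H :
  (L, K) \in transfers t -> (K, H) \in transfers t -> (L, H) \in transfers t.
Proof. by have [_ tt _ _ _] := is_transferP _ (valP t); apply: tt. Qed.

Lemma transfer_sub t K H : (K, H) \in transfers t -> K \subset H.
Proof. by have [_ _ it _ _] := is_transferP _ (valP t); apply: it. Qed.

Lemma transfer_conj t K H g : (K, H) \in transfers t ->
  ((K :^ g^-1)%G, (H :^ g^-1)%G) \in transfers t.
Proof. by have [_ _ _ ct _] := is_transferP _ (valP t); apply: ct. Qed.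

Lemma transfer_res t K H L : (K, H) \in transfers t -> L \subset H ->
  ((L :&: K)%G, L) \in transfers t.
Proof. by have [_ _ _ _ st] := is_transferP _ (valP t); apply: st. Qed.

(** Allows subgroups to be rewritten through equalities of their underlying sets. *)
Lemma transfer_congr t K K' H H' : K :=: K' -> H :=: H' ->
  (K, H) \in transfers t -> (K', H') \in transfers t.
Proof. by move=> /group_inj-> /group_inj->. Qed.

Lemma eq_transfers t t' :
  (forall K H, (K, H) \in transfers t = ((K, H) \in transfers t')) -> t = t'.
Proof. by move=> tt'; apply/val_inj/setP=> -[K H]; apply: tt'. Qed.

(** Together with its dual, this turns both sides of each adjunction into inclusions between
    explicit relations. *)
Lemma least_containing_le R t t' :
  least_containing R t -> (t <= t')%O = (R \subset transfers t').
Proof.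
case/andP=> Rt /forallP/(_ t')/implyP tmin.
by apply/idP/idP=> [|/tmin//]; apply: subset_trans.
Qed.

Lemma largest_contained_le R t t' :
  largest_contained R t -> (t' <= t)%O = (transfers t' \subset R).
Proof.
case/andP=> tR /forallP/(_ t')/implyP tmax.
by apply/idP/idP=> [t't|/tmax//]; apply: subset_trans tR.
Qed.

End TransferLemmas.

(** * The two adjunctions and explicit right adjoints *)

Section InducedLemmas.
Variables (gT rT : finGroupType) (f : {morphism [set: gT] >-> rT}).

Lemma f_L_adjunction : order_adjunction (f_L f) (finv_R f).
Proof.
move=> s t; rewrite (least_containing_le _ (f_L_least f s)).
rewrite (largest_contained_le _ (finv_R_largest f t)).
split=> /subsetP st; apply/subsetP.
  move=> -[K H] sKH; rewrite inE /= (transfer_sub sKH).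
  by apply: st; apply/imsetP; exists (K, H).
by move=> _ /imsetP[p /st + ->]; rewrite inE => /andP[].
Qed.

Lemma finv_L_adjunction : order_adjunction (finv_L f) (f_R f).
Proof.
move=> t s; rewrite (least_containing_le _ (finv_L_least f t)).
rewrite (largest_contained_le _ (f_R_largest f s)).
split=> /subsetP st; apply/subsetP.
  move=> -[K H] tKH; rewrite inE /= (transfer_sub tKH).
  by apply: st; apply/imsetP; exists (K, H).
by move=> _ /imsetP[p /st + ->]; rewrite inE => /andP[].
Qed.

(** Conjugation by [g] maps under [f] to conjugation by [f g], under which [t] is closed, so
    imposing all restrictions already gives a transfer system. Maximality then places it below
    [finv_R f t]. *)
Lemma finv_RP (t : transfer_system rT) (K H : {group gT}) :
  reflect (K \subset H /\ forall L : {group gT}, L \subset H ->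
             ((f @* (L :&: K))%G, (f @* L)%G) \in transfers t)
          ((K, H) \in transfers (finv_R f t)).
Proof.
have /andP[/subsetP inP _] := finv_R_largest f t.
apply: (iffP idP) => [KH | [KH resKH]].
  split=> [|L LH]; first exact: transfer_sub KH.
  by have := inP _ (transfer_res KH LH); rewrite inE => /andP[].
pose S := [set p : {group gT} * {group gT} | (p.1 \subset p.2) &&
  [forall L : {group gT}, (L \subset p.2) ==>
     (((f @* (L :&: p.1))%G, (f @* L)%G) \in transfers t)]].
have inS (K' H' : {group gT}) :
  reflect (K' \subset H' /\ forall L : {group gT}, L \subset H' ->
     ((f @* (L :&: K'))%G, (f @* L)%G) \in transfers t) ((K', H') \in S).
  rewrite inE /=; apply: (iffP andP) => -[K'H' h]; split=> //.
    by move=> L; apply/implyP; move/forallP: h.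
  by apply/forallP=> L; apply/implyP/h.
have trS : is_transfer S.
  apply/is_transferP; split=> [A|C B A|B A|B A g|B A C].
  - apply/inS; split=> // L /setIidPl LA.
    have -> : (L :&: A)%G = L by apply: group_inj.
    exact: transfer_refl.
  - move=> /inS[CB h1] /inS[BA h2]; apply/inS.
    split=> [|L LA]; first exact: subset_trans CB BA.
    (* Restrict the first relation to [L :&: B], whose intersection with [C] is [L :&: C]. *)
    apply: transfer_trans (h2 L LA).
    have := h1 (L :&: B)%G (subsetIr _ _).
    suff -> : (L :&: B :&: C)%G = (L :&: C)%G by [].
    by apply: group_inj; rewrite /= -setIA (setIidPr CB).
  - by case/inS.
  - move=> /inS[BA h]; apply/inS; split=> [|L LA]; first by rewrite conjSg.
    (* Move [L] back inside [A], restrict there, then conjugate the images by [f g]. *)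
    have LA' : (L :^ g)%G \subset A by rewrite /= sub_conjg.
    apply: transfer_congr (transfer_conj (f g) (h _ LA')) => /=.
      by rewrite -morphV ?inE // -morphimJ ?inE // conjIg conjsgK.
    by rewrite -morphV ?inE // -morphimJ ?inE // conjsgK.
  - move=> /inS[BA h] CA; apply/inS; split=> [|L LC]; first exact: subsetIl.
    have := h L (subset_trans LC CA).
    suff -> : (L :&: B)%G = (L :&: (C :&: B))%G by [].
    by apply: group_inj; rewrite /= setIA (setIidPl LC).
suff /subsetP : (TransferSystem trS <= finv_R f t)%O by apply; apply/inS.
rewrite (largest_contained_le _ (finv_R_largest f t)).
apply/subsetP=> -[B A] /inS[BA /(_ A (subxx _))]; rewrite inE /= BA.
by have -> : (A :&: B)%G = B by apply/group_inj/setIidPr.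
Qed.

(** Preimages commute with intersections, so restriction is inherited from [s]. Conjugation by [y]
    outside the image of [f] has no counterpart in [gT], hence the quantification over all [y]. *)
Lemma f_RP (s : transfer_system gT) (K H : {group rT}) :
  reflect (K \subset H /\ forall y : rT,
             ((f @*^-1 (K :^ y^-1))%G, (f @*^-1 (H :^ y^-1))%G) \in transfers s)
          ((K, H) \in transfers (f_R f s)).
Proof.
have /andP[/subsetP inP _] := f_R_largest f s.
apply: (iffP idP) => [KH | [KH conjKH]].
  split=> [|y]; first exact: transfer_sub KH.
  by have := inP _ (transfer_conj y KH); rewrite inE => /andP[].
pose S := [set p : {group rT} * {group rT} | (p.1 \subset p.2) &&
  [forall y : rT,
     ((f @*^-1 (p.1 :^ y^-1))%G, (f @*^-1 (p.2 :^ y^-1))%G) \in transfers s]].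
have inS (K' H' : {group rT}) : reflect (K' \subset H' /\ forall y : rT,
     ((f @*^-1 (K' :^ y^-1))%G, (f @*^-1 (H' :^ y^-1))%G) \in transfers s)
     ((K', H') \in S).
  by rewrite inE /=; apply: (iffP andP) => -[K'H' h]; split=> //; apply/forallP.
have trS : is_transfer S.
  apply/is_transferP; split=> [A|C B A|B A|B A g|B A C].
  - by apply/inS; split=> // y; apply: transfer_refl.
  - move=> /inS[CB h1] /inS[BA h2]; apply/inS.
    split=> [|y]; first exact: subset_trans CB BA.
    exact: transfer_trans (h1 y) (h2 y).
  - by case/inS.
  - move=> /inS[BA h]; apply/inS; split=> [|y]; first by rewrite conjSg.
    (* Conjugating the pair by [g] only shifts the parameter from [y] to [y * g]. *)
    by apply: transfer_congr (h (y * g)); rewrite /= invMg conjsgM.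
  - move=> /inS[BA h] CA; apply/inS; split=> [|y]; first exact: subsetIl.
    have CA' : (f @*^-1 (C :^ y^-1))%G \subset (f @*^-1 (A :^ y^-1))%G.
      by apply: morphpreS; rewrite conjSg.
    by apply: transfer_congr (transfer_res (h y) CA');
       rewrite //= conjIg morphpreI.
suff /subsetP : (TransferSystem trS <= f_R f s)%O by apply; apply/inS.
rewrite (largest_contained_le _ (f_R_largest f s)).
apply/subsetP=> -[B A] /inS[BA h]; rewrite inE /= BA.
by apply: transfer_congr (h 1); rewrite /= invg1 conjsg1.
Qed.

End InducedLemmas.

(** * Identity laws *)

Section Identity.
Variable gT : finGroupType.
Let id_gT := idm_morphism [set: gT].

Lemma finv_R_id : finv_R id_gT =1 id.
Proof.
move=> t; apply: eq_transfers => K H.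
have imE (L : {group gT}) : (id_gT @* L)%G = L.
  by apply: group_inj; rewrite /= morphim_idm ?subsetT.
apply/finv_RP/idP => [[KH /(_ H (subxx _))] | KH].
  by rewrite !imE; apply: transfer_congr; rewrite //= (setIidPr KH).
split=> [|L LH]; first exact: transfer_sub KH.
by rewrite !imE; apply: transfer_res LH.
Qed.

Lemma f_R_id : f_R id_gT =1 id.
Proof.
move=> s; apply: eq_transfers => K H.
have preE (L : {group gT}) : (id_gT @*^-1 L)%G = L.
  by apply/group_inj/setP=> x; rewrite !inE.
apply/f_RP/idP => [[KH h] | KH].
  by apply: transfer_congr (h 1); rewrite preE /= invg1 conjsg1.
split=> [|y]; first exact: transfer_sub KH.
by rewrite !preE; apply: transfer_conj.
Qed.

Lemma f_L_id : f_L id_gT =1 id.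
Proof.
exact: left_adjoint_unique (f_L_adjunction _) (@adjunction_id _ _) finv_R_id.
Qed.

Lemma finv_L_id : finv_L id_gT =1 id.
Proof.
exact: left_adjoint_unique (finv_L_adjunction _) (@adjunction_id _ _) f_R_id.
Qed.

End Identity.

(** * Composition laws *)

Section Composition.
Variables (aT bT cT : finGroupType).
Variables (g : {morphism [set: bT] >-> cT}) (f : {morphism [set: aT] >-> bT}).

(** The restriction conditions agree because every subgroup of [f @* L] is the image of a subgroup
    of [L]; conversely, it suffices to test on [f @* L] itself. *)
Lemma finv_R_comp : finv_R (compm g f) =1 finv_R f \o finv_R g.
Proof.
move=> t; apply: eq_transfers => K H.
have imE (L : {group aT}) : (compm g f @* L)%G = (g @* (f @* L))%G.
  by apply: group_inj; rewrite /= /morphim !setTI imset_comp.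
apply/finv_RP/finv_RP => -[KH h]; split=> // L LH.
  apply/finv_RP; split=> [|M ML]; first by rewrite morphimS ?subsetIl.
  (* [N] maps onto [M], as [M] lies in [f @* L], and [N :&: K] maps onto [M :&: f @* (L :&: K)]. *)
  pose N := (L :&: f @*^-1 M)%G.
  have NE : f @* N = M by rewrite morphim_setIpre (setIidPr ML).
  have NKE : f @* (N :&: K) = M :&: f @* (L :&: K).
    by rewrite /= setIAC morphim_setIpre setIC.
  have := h N (subset_trans (subsetIl _ _) LH); rewrite !imE.
  by apply: transfer_congr; rewrite /= ?NKE ?NE.
have /finv_RP[LKL /(_ _ (subxx _))] := h L LH; rewrite !imE.
by apply: transfer_congr; rewrite //= (setIidPr LKL).
Qed.

(** Conjugating a [g]-preimage by [y] gives the [g]-preimage of the conjugate by [g y], so the two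
    successive conjugations merge into one by [g y * z]; the choice [y = 1] gives the converse. *)
Lemma f_R_comp : f_R (compm g f) =1 f_R g \o f_R f.
Proof.
move=> s; apply: eq_transfers => K H.
have preE (L : {group cT}) : (compm g f @*^-1 L)%G = (f @*^-1 (g @*^-1 L))%G.
  by apply/group_inj/setP=> x; rewrite !inE.
apply/f_RP/f_RP => -[KH h]; split=> // z; last first.
  have /f_RP[_ /(_ 1)] := h z; rewrite !preE.
  by apply: transfer_congr; rewrite /= invg1 conjsg1.
apply/f_RP; split=> [|y]; first by rewrite morphpreS ?conjSg.
have := h (g y * z); rewrite !preE.
by apply: transfer_congr;
   rewrite /= invMg conjsgM -morphV ?inE // morphpreJ ?inE.
Qed.

Lemma f_L_comp : f_L (compm g f) =1 f_L g \o f_L f.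
Proof.
apply: left_adjoint_unique (f_L_adjunction _) _ finv_R_comp.
exact: adjunction_comp (f_L_adjunction f) (f_L_adjunction g).
Qed.

Lemma finv_L_comp : finv_L (compm g f) =1 finv_L f \o finv_L g.
Proof.
apply: left_adjoint_unique (finv_L_adjunction _) _ f_R_comp.
exact: adjunction_comp (finv_L_adjunction g) (finv_L_adjunction f).
Qed.

End Composition.

(** * Assembly of the four functors *)

(* Stated over an arbitrary category [C] with the objects of [FinGrp], so as to
   cover both [FinGrp] and [op FinGrp]. *)
Lemma functor_of_maps (C : category) (T : C -> FinPos)
    (F : forall a b : C, hom a b -> T a -> T b) :
    (forall a b (f : hom a b), {homo F a b f : x y / (x <= y)%O}) ->
    (forall a, F a a (idc a) =1 id) ->
    (forall a b c (g : hom b c) (f : hom a b),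
       F a c (compc g f) =1 F b c g \o F a b f) ->
  exists Phi : functor_on T, forall a b (f : hom a b), fmap Phi f =1 F a b f.
Proof.
move=> Fhomo F1 Fcomp.
pose mor a b (f : hom a b) := Order.isOrderMorphism.Build _ _ _ _ _ (Fhomo a b f).
pose Ff a b (f : hom a b) : hom (T a) (T b) :=
  HB.pack_for {omorphism (T a) -> (T b)} (F a b f) (mor a b f).
have Ff1 a : Ff a a (idc a) = idc (T a) by apply: omorphism_eq => x; apply: F1.
have FfM a b c (g : hom b c) (f : hom a b) :
    Ff a c (compc g f) = compc (Ff b c g) (Ff a b f).
  by apply: omorphism_eq => x; apply: Fcomp.
by exists (FunctorOn Ff1 FfM).
Qed.

Theorem proposition5p9 :
  (exists (FL FR : @functor_on FinGrp FinPos Tr)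
          (FinvL FinvR : @functor_on (op FinGrp) FinPos Tr),
     forall (gT rT : finGroupType) (f : {morphism [set: gT] >-> rT}),
       [/\ @fmap _ _ _ FL gT rT f =1 f_L f,
           @fmap _ _ _ FR gT rT f =1 f_R f,
           @fmap _ _ _ FinvL rT gT f =1 finv_L f &
           @fmap _ _ _ FinvR rT gT f =1 finv_R f])
  /\
  (forall (gT rT : finGroupType) (f : {morphism [set: gT] >-> rT}),
     order_adjunction (f_L f) (finv_R f) /\
     order_adjunction (finv_L f) (f_R f)).
Proof.
split; last first.
  by move=> gT rT f; split; [apply: f_L_adjunction | apply: finv_L_adjunction].
have [FL FLE] := @functor_of_maps FinGrp Tr (@f_L)
  (fun _ _ f => adjunction_homo_left (f_L_adjunction f)) f_L_id f_L_comp.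
have [FR FRE] := @functor_of_maps FinGrp Tr (@f_R)
  (fun _ _ f => adjunction_homo_right (finv_L_adjunction f)) f_R_id f_R_comp.
(* An arrow from [b] to [a] in [op FinGrp] is a homomorphism from [a] to [b], so both the groups and
   the factors of a composite are swapped. *)
have [FinvL FinvLE] := @functor_of_maps (op FinGrp) Tr (fun b a => @finv_L a b)
  (fun _ _ f => adjunction_homo_left (finv_L_adjunction f)) finv_L_id
  (fun _ _ _ f g => finv_L_comp g f).
have [FinvR FinvRE] := @functor_of_maps (op FinGrp) Tr (fun b a => @finv_R a b)
  (fun _ _ f => adjunction_homo_right (f_L_adjunction f)) finv_R_id
  (fun _ _ _ f g => finv_R_comp g f).
exists FL, FR, FinvL, FinvR => gT rT f.
split; [exact: FLE | exact: FRE | exact: FinvLE | exact: FinvRE].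
Qed.
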